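(* Let $H$ be a nonzero complex Hilbert space and let $A$ and $B$ be (possibly unbounded) self-adjoint operators on $H$. If $A$ and $B$ satisfy the Heisenberg Commutation Relation, then at least one of the following holds: (1) $\operatorname{dom}[A,B]$ is not a core for both $A$ and $B$ (that is, it fails to be a core for at least one of $A$, $B$); or (2) both $A$ and $B$ are unbounded.
   Context: For self-adjoint operators $A$, $B$ with domains $\operatorname{dom}A$, $\operatorname{dom}B$, set $$\operatorname{dom}[A,B]=\{h\in\operatorname{dom}A\cap\operatorname{dom}B: Ah\in\operatorname{dom}B,\ Bh\in\operatorname{dom}A\},$$ and $[A,B]h=ABh-BAh$ for $h\in\operatorname{dom}[A,B]$. We say that $A$ and $B$ satisfy the Heisenberg Commutation Relation if there is a dense subspace $K$ of $H$ with $K\subseteq\operatorname{dom}[A,B]$ and $[A,B]k=ik$ for all $k\in K$. A subspace $\mathscr{X}\subseteq \operatorname{dom}T$ is a core for a closed operator $T$ if the closure of $T|_{\mathscr{X}}$ is $T$. *)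

(* Defs.v *)
From HB Require Import structures.
From mathcomp Require Import all_boot all_order all_algebra.
From mathcomp Require Import complex.
From mathcomp Require Import boolp classical_sets reals topology normedtype.
Import Order.TTheory GRing.Theory Num.Theory.
Import numFieldNormedType.Exports.

Set Implicit Arguments.
Unset Strict Implicit.
Unset Printing Implicit Defensive.

Local Open Scope classical_set_scope.
Local Open Scope ring_scope.
Local Open Scope complex_scope.

(* Complex Hilbert spaces: complete normed modules over R[i] whose norm comes
   from an inner product. By the convention of {dot H for Num.conj}, the inner
   product is linear in its first argument and conjugate-linear in its
   second. *)
HB.mixin Record CompleteNormedModule_isHilbert (R : realType) H
    of CompleteNormedModule R[i] H := {
  inner : {dot H for @Num.conj R[i]} ;
  inner_normE : forall h : H, `|h| ^+ 2 = inner h h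
}.

#[short(type="hilbertType")]
HB.structure Definition Hilbert (R : realType) :=
  {H of CompleteNormedModule_isHilbert R H & CompleteNormedModule R[i] H}.

Definition is_subspace (K : numFieldType) (V : lmodType K) (X : set V) : Prop :=
  submod_closed (fun v : V => v \in X).

(* A not necessarily bounded linear operator in H. The values of opfun outside
   opdom are junk: every notion below only looks at opfun on opdom. *)
Record operator (R : realType) (H : hilbertType R) := Operator {
  opdom : set H ;
  opfun :> H -> H ;
  opdom_subspace : is_subspace opdom ;
  opfun_linear : forall (a : R[i]) (u v : H), opdom u -> opdom v ->
    opfun (a *: u + v) = a *: opfun u + opfun v
}.

Section Operators.
Variables (R : realType) (H : hilbertType R).
Implicit Types (A B T : operator H) (X : set H).

Definition graph_on T X : set (H * H) :=
  [set p | X p.1 /\ p.2 = T p.1].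

Definition graph T : set (H * H) := graph_on T (opdom T).

(* For a densely defined T, this is the graph of the adjoint of T. *)
Definition adjoint_graph T : set (H * H) :=
  [set p | forall h, opdom T h -> inner (T h) p.1 = inner h p.2].

Definition self_adjoint T : Prop :=
  dense (opdom T) /\ adjoint_graph T = graph T.

Definition bounded_operator T : Prop :=
  exists M : R, forall h, opdom T h -> `|T h| <= M%:C * `|h|.

Definition unbounded_operator T : Prop := ~ bounded_operator T.

Definition commutator_dom A B : set H :=
  [set h | [/\ opdom A h, opdom B h, opdom B (A h) & opdom A (B h)]].

Definition commutator A B (h : H) : H := A (B h) - B (A h).

Definition heisenberg_commutation A B : Prop :=
  exists K : set H, [/\ is_subspace K, dense K, K `<=` commutator_dom A B
    & forall k, K k -> commutator A B k = 'i *: k].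

(* The closure of the restriction of T to X is the operator whose graph is the
   closure of graph_on T X in H * H. *)
Definition is_core T X : Prop :=
  [/\ is_subspace X, X `<=` opdom T & closure (graph_on T X) = graph T].

End Operators.

(* Main.v *)
(* Suppose one operator, say A, is bounded (hence everywhere defined) and
   dom[A,B] is a core for B. The relation A B - B A = c holds on dom[A,B] by
   symmetry of A and B and density of K, and on all of dom B because B is the
   closure of its restriction to dom[A,B]. With the resolvent S = (B + i)^-1 and
   the Cayley transform U = (B - i) S = 1 - 2 i S it becomes
   A S - S A = - c S^2, hence A U^n - U^n A = 2 i c n S^2 U^(n-1). As U is an
   isometry commuting with S, this gives 2 |c| n |S^2 h| <= 2 |A| |h| for all n,
   so S^2 = 0; but S is injective, so H = 0. *)
Require Import Defs.
From mathcomp Require Import all_boot all_order all_algebra complex ring.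
From mathcomp Require Import boolp classical_sets reals interval_inference.
From mathcomp Require Import topology normedtype.
Import Order.TTheory GRing.Theory Num.Theory.
Import numFieldNormedType.Exports.

Set Implicit Arguments.
Unset Strict Implicit.
Unset Printing Implicit Defensive.

Local Open Scope classical_set_scope.
Local Open Scope ring_scope.

(** * Inner product identities and the Cauchy-Schwarz inequality *)

Section InnerProduct.
Variables (R : realType) (H : hilbertType R).
Implicit Types (u v w : H) (a : R[i]).
Local Notation "[< u , v >]" := (inner u v) (format "[< u ,  v >]").

Lemma innerDl u v w : [< u + v, w >] = [< u, w >] + [< v, w >].
Proof. exact: linearDl. Qed.

Lemma innerDr u v w : [< w, u + v >] = [< w, u >] + [< w, v >].
Proof. exact: raddfD. Qed.

Lemma innerZl a u v : [< a *: u, v >] = a * [< u, v >].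
Proof. exact: linearZl_LR. Qed.

Lemma innerZr a u v : [< u, a *: v >] = a^* * [< u, v >].
Proof. exact: linearZr_LR. Qed.

Lemma innerNl u v : [< - u, v >] = - [< u, v >].
Proof. by rewrite -scaleN1r innerZl mulN1r. Qed.

Lemma innerNr u v : [< u, - v >] = - [< u, v >].
Proof. by rewrite -scaleN1r innerZr rmorphN rmorph1 mulN1r. Qed.

Lemma innerBl u v w : [< u - v, w >] = [< u, w >] - [< v, w >].
Proof. by rewrite innerDl innerNl. Qed.

Lemma innerBr u v w : [< w, u - v >] = [< w, u >] - [< w, v >].
Proof. by rewrite innerDr innerNr. Qed.

Lemma inner_conj u v : [< u, v >] = ([< v, u >])^*.
Proof. by rewrite (hermC (@inner R H)) expr0 mul1r. Qed.

Lemma inner_self_eq0 u : [< u, u >] = 0 -> u = 0.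
Proof. by move=> u0; apply/normr0_eq0/eqP; rewrite -sqrf_eq0 inner_normE u0. Qed.

Lemma normsqD u v :
  `|u + v| ^+ 2 = `|u| ^+ 2 + `|v| ^+ 2 + ([< u, v >] + [< v, u >]).
Proof. rewrite !inner_normE innerDl !innerDr; ring. Qed.

Lemma parallelogram u v :
  `|u + v| ^+ 2 + `|u - v| ^+ 2 = 2 * (`|u| ^+ 2 + `|v| ^+ 2).
Proof. rewrite !normsqD !normrN innerNr innerNl; ring. Qed.

(* Dividing by [`|v| ^+ 2] is harmless at [v = 0], where the quotient is 0. *)
Lemma normsq_residual u v :
  `|u - ([< u, v >] / `|v| ^+ 2) *: v| ^+ 2
    = `|u| ^+ 2 - `|[< u, v >]| ^+ 2 / `|v| ^+ 2.
Proof.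
have [->|v0] := eqVneq v 0.
  by rewrite normr0 expr0n /= invr0 !mulr0 scaler0 !subr0.
have nv0 : `|v| ^+ 2 != 0 by rewrite sqrf_eq0 normr_eq0.
set a := _ / _.
have ac : a^* = [< v, u >] / `|v| ^+ 2.
  rewrite /a rmorphM fmorphV /= -inner_conj; congr (_ / _).
  by rewrite geC0_conj // exprn_ge0.
rewrite normsqD normrN normrZ innerNr innerNl innerZr innerZl ac exprMn !normCK.
rewrite ac -inner_conj /a; field.
by move: nv0; rewrite sqrf_eq0.
Qed.

Lemma cauchy_schwarz u v : `|[< u, v >]| <= `|u| * `|v|.
Proof.
have [->|v0] := eqVneq v 0.
  by rewrite -(scale0r 0) innerZr rmorph0 mul0r normr0 scale0r normr0 mulr0.
have nv0 : 0 < `|v| ^+ 2 by rewrite exprn_gt0 ?normr_gt0.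
rewrite -(@ler_pXn2r _ 2) ?nnegrE ?mulr_ge0 // exprMn -ler_pdivrMr //.
by rewrite -subr_ge0 -normsq_residual exprn_ge0.
Qed.

End InnerProduct.

(** * Limits and vanishing from approximations at every scale *)

Section Completeness.
Variables (R : realType).

(** A positive complex number is real, so the Archimedean property passes from [R] to [R[i]]. *)
Lemma invS_small (e : R[i]) : 0 < e ->
  exists N, forall n, (N <= n)%N -> n.+1%:R^-1 < e.
Proof.
move=> e0; have /complex_realP[r er] : e \is Num.real by rewrite realE ltW.
move: e0; rewrite {}er ltcR => r0.
have [N _ HN] := near_infty_natSinv_lt (PosNum r0).
exists N => n /HN /=; rewrite -ltcR fmorphV rmorph_nat; exact.
Qed.

Variable H : hilbertType R.

(** Read [P e u] as: u approximates an unknown target up to e. Choices for e = 1/(n+1) form a Cauchy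
    sequence, and its limit is the target. It serves for projections, for totality of bounded
    operators and for preimages under T + i. *)
Lemma complete_approx (P : R[i] -> H -> Prop) :
    (forall e, 0 < e -> exists u, P e u) ->
    (forall e e' u u', 0 < e -> 0 < e' -> P e u -> P e' u' -> `|u - u'| <= e + e') ->
  exists l, forall e u, 0 < e -> P e u -> `|l - u| <= e.
Proof.
move=> Pex Pcauchy.
have s_gt0 n : 0 < n.+1%:R^-1 :> R[i] by rewrite invr_gt0 ltr0n.
have /choice[x Px] : forall n, exists u, P n.+1%:R^-1 u by move=> n; apply: Pex.
have x_cauchy : cauchy (x @ \oo).
  apply: cauchy_exP => e e0.
  have e20 : 0 < e / 2 by rewrite divr_gt0.
  have [N HN] := invS_small e20.
  exists (x N), N => // n /= Nn; rewrite -ball_normE /=.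
  apply: (le_lt_trans (Pcauchy _ _ _ _ _ _ (Px N) (Px n))) => //.
  by rewrite [ltRHS]splitr ltrD ?HN.
have x_cvg : cvg (x @ \oo) by apply/cauchy_cvgP.
have /(@cvgrPdist_lt _ H) x_lim := x_cvg.
exists (lim (x @ \oo)) => e u e0 Pu; apply/ler_addgt0Pr => d d0.
have d20 : 0 < d / 2 by rewrite divr_gt0.
have [N1 _ HN1] := x_lim _ d20; have [N2 HN2] := invS_small d20.
pose n := maxn N1 N2.
have -> : lim (x @ \oo) - u = (lim (x @ \oo) - x n) + (x n - u).
  by rewrite addrA subrK.
apply: (le_trans (ler_normD _ _)).
rewrite (splitr d) addrCA lerD //.
  by rewrite ltW // HN1 //= leq_maxl.
rewrite addrC (le_trans (Pcauchy _ _ _ _ _ _ (Px n) Pu)) // lerD2r ltW //.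
by rewrite HN2 // leq_maxr.
Qed.

Lemma small_eq0 (x c : R[i]) : (forall e, 0 < e -> `|x| <= e * c) -> x = 0.
Proof.
move=> xc; apply/eqP; apply/negPn/negP => x0.
have nx : 0 < `|x| by rewrite normr_gt0.
have c0 : 0 < c by apply: (lt_le_trans nx); rewrite -[leRHS]mul1r xc.
have := xc (`|x| / (2 * c)).
rewrite divr_gt0 ?mulr_gt0 // => /(_ isT).
have -> : `|x| / (2 * c) * c = `|x| / 2 by field; rewrite gt_eqF.
by rewrite ler_pdivlMr // mulr_natr mulr2n gerDl normr_le0 (negPf x0).
Qed.

End Completeness.

(** * Dense subspaces and orthogonal projection *)

Section Subspaces.
Variables (R : realType) (H : hilbertType R).
Implicit Types (X : set H) (e : R[i]).

Lemma subspace0 X : is_subspace X -> X 0.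
Proof. by case=> + _; rewrite unfold_in /= in_setE. Qed.

Lemma subspace_lin X (a : R[i]) u v : is_subspace X -> X u -> X v -> X (a *: u + v).
Proof.
case=> _ /(_ a u v) lin Xu Xv; move: lin.
by rewrite !unfold_in /= !in_setE; apply.
Qed.

Lemma subspaceZ X (a : R[i]) u : is_subspace X -> X u -> X (a *: u).
Proof. by move=> sX Xu; rewrite -[_ *: _]addr0; apply: subspace_lin (subspace0 sX). Qed.

Lemma subspaceD X u v : is_subspace X -> X u -> X v -> X (u + v).
Proof. by move=> sX Xu; rewrite -[u]scale1r; apply: subspace_lin. Qed.

Lemma dense_approx X u e : dense X -> 0 < e -> exists2 x, X x & `|u - x| < e.
Proof.
move=> dX e0; have [||x []] := dX (ball u e).
- by exists u; apply: ballxx.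
- exact: ball_open.
by rewrite -ball_normE /= => ux Xx; exists x.
Qed.

(** Minimizing the distance from y to X. As X need not be closed, p is only a limit of points of
    X. *)
Lemma orthogonal_projection X y : is_subspace X ->
  exists p, (forall e, 0 < e -> exists2 x, X x & `|p - x| <= e)
    /\ forall x, X x -> inner (y - p) x = 0.
Proof.
move=> sX; pose f x : R := complex.Re (`|y - x| ^+ 2).
have fE x : `|y - x| ^+ 2 = (f x)%:C%C.
  by rewrite RRe_real // realE exprn_ge0.
have f_lb : has_lbound [set f x | x in X].
  by exists 0 => _ [x _ <-]; rewrite -lecR -fE exprn_ge0.
pose d : R[i] := (inf [set f x | x in X])%:C%C.
have d_le x : X x -> d <= `|y - x| ^+ 2.
  by move=> Xx; rewrite fE lecR; apply: ge_inf => //; exists x.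
(* With the slack e^2/2, the parallelogram law and the midpoint of u and v, which lies in X, give |u
   - v|^2 <= e^2 + e'^2. *)
pose P e x := X x /\ `|y - x| ^+ 2 <= d + e ^+ 2 / 2.
have Pex e : 0 < e -> exists x, P e x.
  move=> e0; have /complex_realP[r er] : e \is Num.real by rewrite realE ltW.
  move: e0; rewrite {}er ltcR => r0.
  have r20 : 0 < r ^+ 2 / 2 by rewrite divr_gt0 ?exprn_gt0.
  have [|_ [x Xx <-] xr] := inf_adherent r20 (E := [set f x | x in X]).
    by split => //; exists (f 0), 0 => //; apply: subspace0.
  exists x; split => //; rewrite fE ltW //.
  move: xr; rewrite -ltcR rmorphD rmorphM fmorphV rmorphXn rmorph_nat; exact.
have Pcauchy e e' u v : 0 < e -> 0 < e' -> P e u -> P e' v -> `|u - v| <= e + e'.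
  move=> e0 e'0 [Xu ue] [Xv ve].
  rewrite -(@ler_pXn2r _ 2) ?nnegrE ?addr_ge0 ?(ltW e0) ?(ltW e'0) //.
  have mid : 4 * d <= `|(y - u) + (y - v)| ^+ 2.
    have -> : (y - u) + (y - v) = 2 *: (y - 2^-1 *: (u + v)).
      rewrite scalerBr scalerA divff // scale1r scaler_nat mulr2n opprD.
      by rewrite addrACA.
    rewrite normrZ exprMn ger0_norm // -natrX ler_pM2l //.
    by apply: d_le; apply: subspaceZ => //; apply: subspaceD.
  have -> : `|u - v| = `|(y - u) - (y - v)|.
    by rewrite distrC opprB [in RHS]addrC addrA subrK.
  rewrite -(lerD2l (4 * d)); apply: le_trans.
    by apply: lerD mid (lexx _).
  rewrite parallelogram; apply: le_trans.
    by apply: ler_wpM2l; [rewrite ler0n|apply: lerD ue ve].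
  have -> : 2 * (d + e ^+ 2 / 2 + (d + e' ^+ 2 / 2)) = 4 * d + (e ^+ 2 + e' ^+ 2).
    by field.
  by rewrite lerD2l sqrrD -addrA lerD2l lerDr mulrn_wge0 // mulr_ge0 // ltW.
have [p Pp] := complete_approx Pex Pcauchy.
exists p; split=> [e e0|x Xx].
  by have [x Px] := Pex e e0; exists x; [case: Px|apply: Pp].
apply: (@small_eq0 _ _ (2 * `|x|)) => e e0; have [v Pv] := Pex e e0.
have [Xv ve] := Pv.
have vx : `|inner (y - v) x| <= e * `|x|.
  have [->|x0] := eqVneq x 0.
    by rewrite -(scale0r 0) innerZr rmorph0 mul0r normr0 scale0r normr0 mulr0.
  have nx : 0 < `|x| ^+ 2 by rewrite exprn_gt0 ?normr_gt0.
  rewrite -(@ler_pXn2r _ 2) ?nnegrE ?mulr_ge0 ?(ltW e0) // exprMn -ler_pdivrMr //.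
  have := normsq_residual (y - v) x; set a := inner (y - v) x / _.
  rewrite -addrA -opprD => res.
  (* The competitor v + a x lowers the squared distance by |<y - v, x>|^2 / |x|^2, so this drop is
     at most the slack e^2/2. *)
  have := d_le (v + a *: x) (subspaceD sX Xv (subspaceZ _ sX Xx)).
  rewrite res lerBrDr => /le_trans/(_ ve); rewrite lerD2l => /le_trans; apply.
  by rewrite ler_pdivrMr // mulr_natr mulr2n lerDl exprn_ge0 ?ltW.
have -> : y - p = (y - v) - (p - v) by rewrite opprB addrA subrK.
rewrite innerBl; apply: (le_trans (ler_normB _ _)).
rewrite mulrA mulr_natr mulr2n mulrDl lerD //.
apply: (le_trans (cauchy_schwarz _ _)); apply: ler_wpM2r => //.
exact: Pp.
Qed.

End Subspaces.

(** * Self-adjoint operators: closedness, surjectivity of T + i, the commutator *)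

Section Operators.
Variables (R : realType) (H : hilbertType R).
Implicit Types (A B T : operator H) (u v h : H) (e c : R[i]).

Lemma opfunB T u v : opdom T u -> opdom T v -> T (u - v) = T u - T v.
Proof. by move=> Tu Tv; rewrite addrC -scaleN1r opfun_linear // scaleN1r addrC. Qed.

Lemma opdomB T u v : opdom T u -> opdom T v -> opdom T (u - v).
Proof.
move=> Tu Tv; rewrite addrC -scaleN1r.
exact: subspace_lin (opdom_subspace T) _ _.
Qed.

Lemma bounded_operator_pos T : bounded_operator T ->
  exists2 m : R[i], 0 < m & forall h, opdom T h -> `|T h| <= m * `|h|.
Proof.
case=> M TM; exists (`|M| + 1)%:C%C; first by rewrite ltcR ltr_wpDl.
move=> h /TM /le_trans; apply; apply: ler_wpM2r => //.
by rewrite lecR (le_trans (ler_norm M)) // lerDl.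
Qed.

Lemma core_approx T X h e : is_core T X -> opdom T h -> 0 < e ->
  exists d, [/\ X d, `|h - d| < e & `|T h - T d| < e].
Proof.
case=> _ _ clX Th e0.
have : graph T (h, T h) by split.
rewrite -clX => /(_ (ball h e `*` ball (T h) e)) [].
  by exists (ball h e, ball (T h) e) => //; split; apply: nbhsx_ballx.
move=> [d q] [[/= Xd ->]]; rewrite -!ball_normE /= => -[hd Td].
by exists d.
Qed.

Lemma adjoint_self T u p : self_adjoint T ->
  (forall h, opdom T h -> inner (T h) u = inner h p) -> opdom T u /\ T u = p.
Proof.
case=> _ adjT Tup; have : adjoint_graph T (u, p) by [].
by rewrite adjT => -[].
Qed.

Lemma self_adjoint_sym T u v : self_adjoint T -> opdom T u -> opdom T v ->
  inner (T u) v = inner u (T v).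
Proof.
case=> _ adjT Tu Tv; have : graph T (v, T v) by split.
by rewrite -adjT; apply.
Qed.

(* The constants [c1] and [c2] save rescaling [e] in applications. *)
Lemma self_adjoint_closed T u p c1 c2 : self_adjoint T ->
    (forall e, 0 < e ->
      exists k, [/\ opdom T k, `|u - k| <= c1 * e & `|p - T k| <= c2 * e]) ->
  opdom T u /\ T u = p.
Proof.
move=> saT Tup; apply: adjoint_self => // h Th; apply/eqP; rewrite -subr_eq0.
apply/eqP/(@small_eq0 _ _ (`|T h| * c1 + `|h| * c2)) => e e0.
have [k [Tk uk pk]] := Tup e e0.
(* Inserting k changes nothing, since <T h, k> = <h, T k> by symmetry. *)
have -> : inner (T h) u - inner h p = inner (T h) (u - k) - inner h (p - T k).
  by rewrite !innerBr (self_adjoint_sym saT Th Tk); ring.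
rewrite mulrDr; apply: (le_trans (ler_normB _ _)).
by apply: lerD; apply: (le_trans (cauchy_schwarz _ _));
   rewrite mulrCA (mulrC e) ler_wpM2l.
Qed.

(** The domain is dense, boundedness makes the images of approximations of h converge, and
    closedness then puts h in the domain. *)
Lemma bounded_self_adjoint_total A m : self_adjoint A -> 0 < m ->
  (forall h, opdom A h -> `|A h| <= m * `|h|) -> forall h, opdom A h.
Proof.
move=> saA m0 Am h.
pose P e q := exists k, [/\ opdom A k, `|h - k| <= m^-1 * e & q = A k].
have Pex e : 0 < e -> exists q, P e q.
  move=> e0; have me0 : 0 < m^-1 * e by rewrite mulr_gt0 ?invr_gt0.
  have [k Ak hk] := dense_approx h saA.1 me0.
  by exists (A k), k; split => //; apply: ltW.
have [|p Pp] := complete_approx Pex.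
  move=> e e' _ _ _ _ [k [Ak hk ->]] [k' [Ak' hk' ->]].
  rewrite -opfunB //; apply: (le_trans (Am _ (opdomB Ak Ak'))).
  rewrite mulrC -ler_pdivlMr // mulrC mulrDr.
  have -> : k - k' = (h - k') - (h - k) by rewrite opprB [RHS]addrC addrA subrK.
  by rewrite [leRHS]addrC; apply: (le_trans (ler_normB _ _)); apply: lerD.
apply: (proj1 (self_adjoint_closed (p := p) (c1 := m^-1) (c2 := 1) saA _)).
move=> e e0; have [q Pq] := Pex e e0; have [k [Ak hk qk]] := Pq.
by exists k; split; rewrite // mul1r -qk; apply: Pp.
Qed.

(** For imaginary s the cross terms cancel by symmetry. The case s = i bounds T + i from below;
    comparing s = i with s = -i makes the Cayley transform isometric. *)
Lemma normsq_shift T s u : self_adjoint T -> opdom T u -> s^* = - s ->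
  `|T u + s *: u| ^+ 2 = `|T u| ^+ 2 + `|s| ^+ 2 * `|u| ^+ 2.
Proof.
move=> saT Tu sC; rewrite normsqD innerZr innerZl sC normrZ exprMn.
by rewrite (self_adjoint_sym saT Tu Tu) mulNr addNr addr0.
Qed.

Lemma norm_le_shift T u : self_adjoint T -> opdom T u ->
  `|u| <= `|T u + 'i *: u|.
Proof.
move=> saT Tu; rewrite -(@ler_pXn2r _ 2) ?nnegrE // normsq_shift ?conjCi //.
by rewrite normCi expr1n mul1r lerDr exprn_ge0.
Qed.

(** The orthogonal complement of the range of T + i consists of eigenvectors of T for i, hence is
    zero, so the range is dense. The lower bound on T + i and closedness of T then make it
    everything. *)
Lemma shift_surjective T y : self_adjoint T ->
  exists2 u, opdom T u & T u + 'i *: u = y.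
Proof.
move=> saT; have sT := opdom_subspace T.
pose X := [set T u + 'i *: u | u in opdom T].
have shift_lin (a : R[i]) u v : opdom T u -> opdom T v ->
    a *: (T u + 'i *: u) + (T v + 'i *: v)
    = T (a *: u + v) + 'i *: (a *: u + v).
  move=> Tu Tv; rewrite opfun_linear // !scalerDr !scalerA (mulrC a) -!addrA.
  by congr (_ + _); rewrite addrCA.
have sX : is_subspace X.
  split=> [|a x x']; rewrite !unfold_in /= !in_setE.
    exists 0; first exact: subspace0.
    have := shift_lin 0 0 0 (subspace0 sT) (subspace0 sT).
    have T0 := opfunB (subspace0 sT) (subspace0 sT).
    by rewrite !subrr in T0; rewrite T0 !scaler0 addr0.
  move=> [u Tu <-] [v Tv <-]; rewrite shift_lin //.
  by exists (a *: u + v) => //; apply: subspace_lin.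
have [p [Xp orth]] := orthogonal_projection y sX.
(* Orthogonality to the range reads <T h, w> = -i <h, w> = <h, i w> for w = y - p. *)
have [Tw Tw_eq] : opdom T (y - p) /\ T (y - p) = 'i *: (y - p).
  apply: adjoint_self => // h Th; rewrite innerZr conjCi.
  have : inner (y - p) (T h + 'i *: h) = 0 by apply: orth; exists h.
  rewrite inner_conj => /eqP; rewrite conjC_eq0 innerDl innerZl addr_eq0.
  by rewrite mulNr => /eqP.
(* Symmetry gives i <w, w> = -i <w, w>. *)
have yp : y = p.
  apply/eqP; rewrite -subr_eq0; apply/eqP/inner_self_eq0/eqP.
  have := self_adjoint_sym saT Tw Tw; rewrite Tw_eq innerZl innerZr conjCi.
  move/eqP; rewrite mulNr -addr_eq0 -mulrDl mulf_eq0 -mulr2n mulrn_eq0 /=.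
  by rewrite (negPf (neq0Ci _)).
pose P e u := opdom T u /\ `|y - (T u + 'i *: u)| <= e.
have Pex e : 0 < e -> exists u, P e u.
  by move=> e0; have [_ [u Tu <-] ue] := Xp e e0; exists u; split; rewrite // yp.
have [|l Pl] := complete_approx Pex.
  move=> e e' u v _ _ [Tu ue] [Tv ve].
  apply: (le_trans (norm_le_shift saT (opdomB Tu Tv))).
  rewrite opfunB // scalerBr addrACA -opprD.
  set a := T u + _ in ue *; set b := T v + _ in ve *.
  have -> : a - b = (y - b) - (y - a) by rewrite opprB [RHS]addrC addrA subrK.
  by rewrite [leRHS]addrC; apply: (le_trans (ler_normB _ _)); apply: lerD.
have [Tl Tl_eq] : opdom T l /\ T l = y - 'i *: l.
  apply: (self_adjoint_closed (c1 := 1) (c2 := 2)) => // e e0.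
  have [u Pu] := Pex e e0; have [Tu ue] := Pu.
  exists u; split; [by []|by rewrite mul1r; apply: Pl|].
  have -> : y - 'i *: l - T u = (y - (T u + 'i *: u)) - 'i *: (l - u).
    by rewrite scalerBr opprB opprD !addrA subrK addrAC.
  rewrite mulrC mulr_natr mulr2n; apply: (le_trans (ler_normB _ _)).
  by apply: lerD => //; rewrite normrZ normCi mul1r; apply: Pl.
by exists l; rewrite // Tl_eq subrK.
Qed.

(** Moving A and B across the inner product onto k in K shows that [A,B]h - ih is orthogonal to the
    dense subspace K. *)
Lemma heisenberg_on_commutator_dom A B h :
    self_adjoint A -> self_adjoint B -> heisenberg_commutation A B ->
  commutator_dom A B h -> commutator A B h = 'i *: h.
Proof.
move=> saA saB [K [_ dK Kdom Kcomm]] [Ah Bh BAh ABh].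
apply/eqP; rewrite -subr_eq0; apply/eqP; set v := _ - _.
have vK k : K k -> inner v k = 0.
  move=> Kk; have [Ak Bk BAk ABk] := Kdom k Kk.
  have -> : inner v k = inner h (- commutator A B k) - 'i * inner h k.
    rewrite /v /commutator !innerBl innerZl opprB innerBr.
    rewrite (self_adjoint_sym saA) // (self_adjoint_sym saB) //.
    by rewrite (self_adjoint_sym saB) // (self_adjoint_sym saA).
  by rewrite Kcomm // innerNr innerZr conjCi mulNr opprK subrr.
clearbody v; apply: inner_self_eq0; apply: (@small_eq0 _ _ `|v|) => e e0.
have [k Kk vk] := dense_approx v dK e0.
have -> : inner v v = inner v (v - k) by rewrite innerBr (vK k) // subr0.
by rewrite mulrC (le_trans (cauchy_schwarz _ _)) // ler_wpM2l // ltW.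
Qed.

End Operators.

(** * Commutation relations with a bounded operator *)

Section BoundedCase.
Variables (R : realType) (H : hilbertType R).
Implicit Types (A B : operator H) (h : H) (c : R[i]).

(** When d in X tends to h in the graph norm of B, continuity of A makes A d and B (A d) = A (B d) -
    c d converge, and B is closed. *)
Lemma commutator_on_domain A B (X : set H) m c :
    (forall h, opdom A h) -> 0 < m -> (forall h, `|A h| <= m * `|h|) ->
    self_adjoint B -> is_core B X -> X `<=` commutator_dom A B ->
    (forall h, X h -> commutator A B h = c *: h) ->
  forall h, opdom B h -> opdom B (A h) /\ B (A h) = A (B h) - c *: h.
Proof.
move=> domA m0 Am saB core Xdom Xc h Bh.
apply: (self_adjoint_closed (c1 := m) (c2 := m + `|c|)) => // e e0.
have [d [Xd hd Bd]] := core_approx core Bh e0.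
have [_ Bd' BAd _] := Xdom d Xd.
have Am_e u v : `|u - v| < e -> `|A u - A v| <= m * e.
  by move=> uv; rewrite -opfunB // (le_trans (Am _)) // ler_wpM2l ?ltW.
exists (A d); split; [by []|exact: Am_e|].
have -> : B (A d) = A (B d) - c *: d by rewrite -(Xc d Xd) opprB addrC subrK.
have -> : A (B h) - c *: h - (A (B d) - c *: d)
    = (A (B h) - A (B d)) - c *: (h - d).
  rewrite scalerBr !opprB -!addrA; congr (_ + _).
  by rewrite addrCA [RHS]addrCA; congr (_ + _); rewrite addrC.
rewrite mulrDl (le_trans (ler_normB _ _)) // lerD ?Am_e //.
by rewrite normrZ ler_wpM2l // ltW.
Qed.

(* [S] is the resolvent (B + i)^-1 and [U] the Cayley transform (B - i)(B + i)^-1. *)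
Lemma bounded_commutation_trivial A B m c :
    (forall h, opdom A h) -> 0 < m -> (forall h, `|A h| <= m * `|h|) ->
    self_adjoint B -> c != 0 ->
    (forall h, opdom B h -> opdom B (A h) /\ B (A h) = A (B h) - c *: h) ->
  forall h : H, h = 0.
Proof.
move=> domA m0 Am saB c0 comm.
have sB := opdom_subspace B.
have /choice[S SP] : forall h, exists u, opdom B u /\ B u + 'i *: u = h.
  by move=> h; have [u] := shift_surjective h saB; exists u.
have domS h : opdom B (S h) by case: (SP h).
have eqS h : B (S h) + 'i *: S h = h by case: (SP h).
(* Injectivity of B + i: identities for [S] can now be checked after applying B + i. *)
have S_uniq u h : opdom B u -> B u + 'i *: u = h -> S h = u.
  move=> Bu <-; apply/eqP; rewrite -subr_eq0 -normr_le0.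
  apply: (le_trans (norm_le_shift saB (opdomB (domS _) Bu))).
  by rewrite opfunB // scalerBr addrACA -opprD eqS subrr normr0.
have S_lin (a : R[i]) u v : S (a *: u + v) = a *: S u + S v.
  apply: S_uniq; first exact: subspace_lin.
  rewrite opfun_linear // -[X in _ = a *: X + _](eqS u) -[X in _ = _ + X](eqS v).
  by rewrite !scalerDr !scalerA (mulrC a) addrACA.
have A_lin (a : R[i]) u v : A (a *: u + v) = a *: A u + A v.
  exact: opfun_linear.
pose U h := h - ('i * 2) *: S h.
have U_lin (a : R[i]) u v : U (a *: u + v) = a *: U u + U v.
  by rewrite /U S_lin !scalerDr scalerN !scalerA (mulrC a) opprD addrACA.
have SU h : S (U h) = U (S h).
  by rewrite /U addrC -scaleNr S_lin scaleNr addrC.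
have UE h : U h = B (S h) + (- 'i) *: S h.
  rewrite /U -{1}(eqS h) -addrA -scaleNr -scalerDl; congr (_ + _ *: _).
  by rewrite mulr_natr mulr2n opprD addrA subrr add0r.
(* Both squared norms equal |B S h|^2 + |S h|^2, as h = (B + i) S h and U h = (B - i) S h. *)
have U_iso h : `|U h| = `|h|.
  apply/eqP; rewrite -(@eqrXn2 _ 2) // UE -{3}(eqS h).
  rewrite !normsq_shift // ?normrN ?conjCi //.
  by rewrite rmorphN /= conjCi.
have AS h : A (S h) = S (A h) - c *: S (S h).
  have [BAS BAS_eq] := comm _ (domS h).
  have -> : S (A h) - c *: S (S h) = S (A h - c *: S h).
    by rewrite -!scaleNr addrC [in RHS]addrC S_lin.
  symmetry; apply: S_uniq => //; rewrite BAS_eq addrAC -[X in _ = A X - _](eqS h).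
  by congr (_ - _); rewrite [in RHS](addrC (B _)) A_lin addrC.
pose k := 'i * 2 * c.
have AU h : A (U h) = U (A h) + k *: S (S h).
  rewrite /U addrC -scaleNr A_lin AS scaleNr scalerBr opprB scalerA -/k.
  by rewrite addrC addrA addrAC.
have iterU_S n h : iter n U (S h) = S (iter n U h).
  by elim: n => //= n ->; rewrite SU.
have iterU_iso n h : `|iter n U h| = `|h|.
  by elim: n => //= n <-.
(* Moving A past each of the n + 1 factors U leaves one term k U^n S^2, because S commutes with
   U. *)
have AUn n h :
    A (iter n.+1 U h) = n.+1%:R * k *: iter n U (S (S h)) + iter n.+1 U (A h).
  elim: n => [|n IHn]; first by rewrite mul1r /= AU addrC.
  rewrite iterS AU IHn U_lin -!iterU_S -!iterS.
  by rewrite addrAC -scalerDl -[n.+2]addn1 natrD mulrDl mul1r.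
have k0 : k != 0 by rewrite /k !mulf_neq0 ?neq0Ci ?pnatr_eq0.
clearbody k.
have SS0 h : S (S h) = 0.
  (* The left side grows linearly in n unless S^2 h = 0, while the isometry U keeps the right side
     independent of n. *)
  have key n : n.+1%:R * `|k| * `|S (S h)| <= m * `|h| * 2.
    have -> : n.+1%:R * `|k| * `|S (S h)| = `|A (iter n.+1 U h) - iter n.+1 U (A h)|.
      by rewrite AUn addrK normrZ iterU_iso normrM normr_nat.
    apply: (le_trans (ler_normB _ _)); rewrite iterU_iso mulr_natr mulr2n lerD //.
    by rewrite (le_trans (Am _)) // iterU_iso.
  apply/normr0_eq0/(@small_eq0 _ _ (m * `|h| * 2 / `|k|)) => e e0; rewrite normr_id.
  have [N /(_ N (leqnn N)) Ne] := invS_small e0.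
  apply: (@le_trans _ _ (N.+1%:R^-1 * (m * `|h| * 2 / `|k|))).
    rewrite mulrA ler_pdivlMr ?normr_gt0 // ler_pdivlMl ?ltr0n //.
    by rewrite (mulrC `|_|) mulrA.
  apply: ler_wpM2r; last exact: ltW.
  by rewrite divr_ge0 // mulr_ge0 // mulr_ge0 // ltW.
have S_inj0 h : S h = 0 -> h = 0.
  have B0 := opfunB (subspace0 sB) (subspace0 sB); rewrite !subrr in B0.
  by move=> Sh; rewrite -(eqS h) Sh B0 scaler0 addr0.
by move=> h; apply/S_inj0/S_inj0.
Qed.

End BoundedCase.

(** Leaving [X] and [c] free lets the same statement serve for (A, B) with c = i and for (B, A) with
    c = -i. *)
Lemma bounded_not_core (R : realType) (H : hilbertType R) (A B : operator H)
    (X : set H) (c : R[i]) :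
    (exists h : H, h != 0) -> self_adjoint A -> self_adjoint B ->
    c != 0 -> X `<=` commutator_dom A B ->
    (forall h, X h -> commutator A B h = c *: h) ->
  bounded_operator A -> ~ is_core B X.
Proof.
move=> [h /eqP h0] saA saB c0 Xdom Xc /bounded_operator_pos[m m0 Am] core.
have domA := bounded_self_adjoint_total saA m0 Am.
have Am' u : `|A u| <= m * `|u| by apply: Am.
apply/h0/(bounded_commutation_trivial domA m0 Am' saB c0).
exact: (commutator_on_domain domA m0 Am' saB core Xdom Xc).
Qed.

Theorem mainTheorem3 (R : realType) (H : hilbertType R) (A B : operator H)
    (H_nonzero : exists h : H, h != 0)
    (A_self_adjoint : self_adjoint A) (B_self_adjoint : self_adjoint B)
    (AB_heisenberg : heisenberg_commutation A B) :
  ~ (is_core A (commutator_dom A B) /\ is_core B (commutator_dom A B)) \/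
  (unbounded_operator A /\ unbounded_operator B).
Proof.
have [cores|] := pselect (is_core A (commutator_dom A B) /\
  is_core B (commutator_dom A B)); last by left.
right; case: cores => coreA coreB.
have i0 : ('i : R[i]) != 0 by rewrite neq0Ci.
have AB_i h : commutator_dom A B h -> commutator A B h = 'i *: h.
  exact: heisenberg_on_commutator_dom.
split=> [bA|bB].
  by apply: (bounded_not_core H_nonzero _ _ i0 (subset_refl _) AB_i bA coreB).
(* Exchanging A and B keeps the commutator domain and changes the sign of the commutator. *)
have Ni0 : (- 'i : R[i]) != 0 by rewrite oppr_eq0.
apply: (bounded_not_core H_nonzero B_self_adjoint A_self_adjoint Ni0 _ _ bB coreA).
  by move=> h [].
by move=> h /AB_i; rewrite /commutator scaleNr => <-; rewrite opprB.
Qed.
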